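(* Let $G$ be one of $\Phi_\alpha$, $\Psi_\alpha$ (for some $\alpha>0$) or $\Lambda$, and let $F$ be a df with $\lim_{n\to\infty}F^n(a_nx+b_n)=G(x)$, $x\in\mathbb{R}$, for some $a_n>0$, $b_n\in\mathbb{R}$. Let $m\ge 1$ be a fixed integer, let $X_1,X_2,\dots$ be iid with df $F$, and for each $n\ge1$ let $N_n$ be a random variable independent of $X_1,X_2,\dots$ with $P(N_n=r)=\frac1n$ for $r=m+1,m+2,\dots,m+n$. Then for every fixed integer $k$ with $1\le k\le m$ and every $x$ with $G(x)>0$, $$\lim_{n\to\infty}F_{k:N_n}(a_nx+b_n)=k\left(\frac{1-G(x)}{-\ln G(x)}\right)-G(x)\sum_{l=1}^{k-1}(k-l)\frac{(-\ln G(x))^{l-1}}{l!}.$$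
   Context: df means distribution function on $\mathbb{R}$. $F_{k:N_n}(x)=P(X_{N_n-k+1:N_n}\le x)=\sum_{r}\sum_{i=0}^{k-1}\binom{r}{i}F^{r-i}(x)(1-F(x))^iP(N_n=r)$ is the df of the $k$-th largest among $X_1,\dots,X_{N_n}$. $\Phi_\alpha(x)=\exp(-x^{-\alpha})$ for $x>0$ and $0$ for $x\le 0$; $\Psi_\alpha(x)=\exp(-|x|^{\alpha})$ for $x<0$ and $1$ for $x\ge 0$; $\Lambda(x)=\exp(-e^{-x})$. The expression $\frac{1-t}{-\ln t}$ is read as $1$ at $t=1$, and $0^0=1$. *)

(* Defs.v *)
From HB Require Import structures.
From mathcomp Require Import all_boot all_order all_algebra finmap.
From mathcomp Require Import all_classical all_reals all_analysis.

Set Implicit Arguments.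
Unset Strict Implicit.
Unset Printing Implicit Defensive.

Import Order.TTheory GRing.Theory Num.Theory.
Import numFieldNormedType.Exports.

Local Open Scope classical_set_scope.
Local Open Scope ring_scope.

Definition Phi (R : realType) (alpha x : R) : R :=
  if 0 < x then expR (- (x `^ (- alpha))) else 0.

Definition Psi (R : realType) (alpha x : R) : R :=
  if x < 0 then expR (- (`|x| `^ alpha)) else 1.

Definition Lambda (R : realType) (x : R) : R := expR (- expR (- x)).

Definition is_extreme_value_df (R : realType) (G : R -> R) : Prop :=
  [\/ exists2 alpha : R, 0 < alpha & G = Phi alpha,
      exists2 alpha : R, 0 < alpha & G = Psi alpha
    | G = @Lambda R].

Definition mutually_independent d (T : measurableType d) (R : realType)
    (P : probability T R) (X : nat -> {RV P >-> R}) : Prop :=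
  forall (J : {fset nat}) (B : nat -> set R),
    (forall i, measurable (B i)) ->
    P (\bigcap_(i in [set` J]) (X i @^-1` B i)) =
    (\prod_(i <- J) P (X i @^-1` B i))%E.

Definition iid_with_df d (T : measurableType d) (R : realType)
    (P : probability T R) (X : nat -> {RV P >-> R}) (F : R -> R) : Prop :=
  mutually_independent X /\ forall i x, cdf (X i) x = (F x)%:E.

Definition sigma_of_family d (T : measurableType d) (R : realType)
    (P : probability T R) (X : nat -> {RV P >-> R}) : set (set T) :=
  <<s \bigcup_i g_sigma_algebra_preimage (X i) >>.

Definition independent_of_family d (T : measurableType d) (R : realType)
    (P : probability T R) (N : {RV P >-> nat}) (X : nat -> {RV P >-> R}) :
    Prop :=
  forall A B, g_sigma_algebra_preimage N A -> sigma_of_family X B ->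
    P (A `&` B) = (P A * P B)%E.

(* The [j]-th smallest entry of [s], for [1 <= j <= size s]. *)
Definition order_stat (R : realType) (s : seq R) (j : nat) : R :=
  nth 0 (sort <=%R s) j.-1.

(* The sample is indexed from 0: [X i] stands for X_(i+1).  The value at an
   outcome where [N w < k] is irrelevant; it is junk when [N w = 0]. *)
Definition kth_largest d (T : measurableType d) (R : realType)
    (P : probability T R) (X : nat -> {RV P >-> R}) (N : {RV P >-> nat})
    (k : nat) (w : T) : R :=
  order_stat [seq X i w | i <- iota 0 (N w)] (N w - k + 1).

Definition df_kth_largest d (T : measurableType d) (R : realType)
    (P : probability T R) (X : nat -> {RV P >-> R}) (N : {RV P >-> nat})
    (k : nat) (x : R) : \bar R :=
  P [set w | kth_largest X N k w <= x].

(* (1 - t) / (- ln t), extended by continuity at t = 1. *)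
Definition log_quotient (R : realType) (t : R) : R :=
  if t == 1 then 1 else (1 - t) / (- ln t).

(* Main.v *)
Require Import Defs.
From HB Require Import structures.
From mathcomp Require Import all_boot all_order all_algebra finmap.
From mathcomp Require Import all_classical all_reals all_analysis.
From mathcomp Require Import ring lra zify.

Set Implicit Arguments.
Unset Strict Implicit.
Unset Printing Implicit Defensive.

Import Order.TTheory GRing.Theory Num.Theory.
Import numFieldNormedType.Exports.

Local Open Scope classical_set_scope.
Local Open Scope ring_scope.

(* Write p = F (a_n x + b_n), q = 1 - p, let b_i(r) be the probability of i
   exceedances of a_n x + b_n among r sample points, and T_k(r) the sum of the
   b_i(r) over i < k.  Since q b_i(r) = T_{i+1}(r) - T_{i+1}(r+1), the mean of
   T_k over the n values of N_n telescopes to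
     (n q)^-1 * \sum_(i < k) (T_{i+1}(m+1) - T_{i+1}(m+n+1)).
   From p^n --> g = G x > 0 one gets p --> 1 and n q --> c = - ln g, so that
   T_{i+1}(m+1) --> 1 while, by the Poisson limit of the binomial law,
   T_{i+1}(m+n+1) --> g * \sum_(j <= i) c^j / j!.  This settles g <> 1; when
   g = 1 the mean lies between p^(m+n) --> 1 and 1. *)

(** * Algebra of binomial probabilities and of their partial sums *)

Section BinomialTails.
Variable R : comRingType.
Implicit Types p : R.

Definition binomial_mass p (r i : nat) : R :=
  'C(r, i)%:R * p ^+ (r - i) * (1 - p) ^+ i.

Definition binomial_cdf p (r k : nat) : R := \sum_(i < k) binomial_mass p r i.

Lemma binomial_massS p r i :
  binomial_mass p r.+1 i.+1 =
  p * binomial_mass p r i.+1 + (1 - p) * binomial_mass p r i.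
Proof.
rewrite /binomial_mass binS natrD subSS exprS.
(* For [r <= i] the exponent [r - i.+1] is truncated, but its coefficient ['C(r, i.+1)] vanishes. *)
case: (ltnP i r) => ir; last by rewrite (@bin_small r i.+1) //; ring.
by rewrite -(subnSK ir) exprS; ring.
Qed.

(** In probabilistic terms, a count of at most [k] is lost at the next trial only if it equals [k]
    and that trial is an exceedance. *)
Lemma binomial_cdfS p r k :
  binomial_cdf p r.+1 k.+1 =
  binomial_cdf p r k.+1 - (1 - p) * binomial_mass p r k.
Proof.
rewrite /binomial_cdf; elim: k => [|k IH].
  by rewrite !big_ord1 /binomial_mass !bin0 !subn0 exprS; ring.
by rewrite big_ord_recr /= IH binomial_massS [in RHS]big_ord_recr /=; ring.
Qed.

Lemma sum_binomial_cdf p m n k :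
  (1 - p) * \sum_(m <= r < m + n) binomial_cdf p r k =
  \sum_(i < k) (binomial_cdf p m i.+1 - binomial_cdf p (m + n) i.+1).
Proof.
rewrite mulr_sumr /binomial_cdf.
under eq_bigr do rewrite mulr_sumr.
rewrite exchange_big /=; apply: eq_bigr => i _.
rewrite -[RHS]opprB -(telescope_sumr (binomial_cdf p ^~ i.+1)) ?leq_addr //.
rewrite -sumrN; apply: eq_bigr => r _.
by rewrite binomial_cdfS; ring.
Qed.

End BinomialTails.

(** By [binomial_cdfS] an extra trial can only lower the sum, so the case of no trials bounds it. *)
Lemma binomial_cdf_le1 (R : realDomainType) (p : R) r k :
  0 <= p <= 1 -> binomial_cdf p r k <= 1.
Proof.
move=> /andP[p0 p1].
case: k => [|k]; first by rewrite /binomial_cdf big_ord0.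
elim: r => [|r IH].
  rewrite /binomial_cdf big_ord_recl /binomial_mass bin0 !expr0 !mulr1.
  by rewrite big1 ?addr0 // => i _; rewrite bin_small // !mul0r.
rewrite binomial_cdfS (le_trans _ IH) // lerBlDr lerDl.
by rewrite !mulr_ge0 ?ler0n ?exprn_ge0 // subr_ge0.
Qed.

Lemma binomial_cdf_ge (R : realDomainType) (p : R) r k : (0 < k)%N ->
  0 <= p <= 1 -> p ^+ r <= binomial_cdf p r k.
Proof.
case: k => // k _ /andP[p0 p1].
rewrite /binomial_cdf big_ord_recl {1}/binomial_mass bin0 subn0 expr0 mul1r mulr1.
rewrite lerDl sumr_ge0 // => i _.
by rewrite !mulr_ge0 ?ler0n ?exprn_ge0 // subr_ge0.
Qed.

(** Grouping by cardinality: this passes from exceedance patterns, encoded as subsets of the sample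
    indices, to the number of exceedances. *)
Lemma sum_subsets_card (V : pzSemiRingType) r k (f : nat -> V) :
  \sum_(S : {set 'I_r} | (#|S| < k)%N) f #|S| = \sum_(j < k) 'C(r, j)%:R * f j.
Proof.
elim: k => [|k IH]; first by rewrite big_ord0 big_pred0.
rewrite big_ord_recr /= -IH (bigID (fun S : {set 'I_r} => (#|S| < k)%N)) /=.
congr (_ + _).
  by apply: eq_bigl => S; rewrite andbC; case: ltnP => // /leqW ->.
rewrite -[in RHS](card_ord r) -card_draws mulr_natl -sumr_const.
apply: eq_big => [S|S /andP[Sk kS]]; first by rewrite inE ltnS -leqNgt eqn_leq.
by congr f; apply/eqP; rewrite eqn_leq -ltnS Sk leqNgt.
Qed.

(** The term [c ^+ j / j!] occurs in the [k - j] inner sums with [j <= i]. The terms with [j = 0]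
    give [k], and the others carry a factor [c], which is pulled out to match the sum in the
    theorem. *)
Lemma sum_exp_partial_sums (R : numFieldType) (c : R) k :
  \sum_(i < k) \sum_(j < i.+1) c ^+ j / j`!%:R =
  k%:R + c * \sum_(1 <= l < k) (k - l)%:R * (c ^+ (l - 1) / l`!%:R).
Proof.
elim: k => [|k IH]; first by rewrite big_ord0 big_geq // mulr0 addr0.
rewrite big_ord_recr /= IH.
have -> : \sum_(1 <= l < k.+1) (k.+1 - l)%:R * (c ^+ (l - 1) / l`!%:R) =
    \sum_(1 <= l < k) (k - l)%:R * (c ^+ (l - 1) / l`!%:R) +
    \sum_(1 <= l < k.+1) c ^+ (l - 1) / l`!%:R.
  (* The added index [l = k] has coefficient [k - k = 0]. *)
  have -> : \sum_(1 <= l < k) (k - l)%:R * (c ^+ (l - 1) / l`!%:R) =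
      \sum_(1 <= l < k.+1) (k - l)%:R * (c ^+ (l - 1) / l`!%:R).
    case: k {IH} => [|k]; first by rewrite !big_geq.
    by rewrite [RHS]big_nat_recr //= subnn mul0r addr0.
  rewrite -big_split; apply: eq_big_nat => l /andP[_ lk] /=.
  by rewrite subSn // -natr1 mulrDl mul1r.
rewrite -(big_mkord xpredT (fun j => c ^+ j / j`!%:R)) big_nat_recl //.
rewrite expr0 fact0 divr1 mulrDr -natr1.
rewrite [in X in _ = _ + (_ + X)]big_add1 /=.
rewrite [in X in _ = _ + (_ + X)]mulr_sumr.
under [in X in _ = _ + (_ + X)]eq_bigr do rewrite subn1 /= mulrA -exprS.
ring.
Qed.

(** * Limits of binomial probabilities when p^n tends to g > 0 *)

Section Limits.
Variable R : realType.

Lemma cvg_invn : n%:R^-1 @[n --> \oo] --> (0 : R).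
Proof.
apply/cvgrVy.
  by near=> n; rewrite invr_gt0 ltr0n; near: n; exact: nbhs_infty_gt.
apply: cvg_trans (@cvgr_idn R); apply: near_eq_cvg.
by near=> n; rewrite /= invrK.
Unshelve. all: by end_near.
Qed.

Lemma cvgX_seq (u : nat -> R) (l : R) i : u n @[n --> \oo] --> l ->
  u n ^+ i @[n --> \oo] --> l ^+ i.
Proof. by move=> ul; exact: (continuous_cvg _ (@exprn_continuous R i l) ul). Qed.

(** Taking logarithms, n ln p tends to ln g; dividing by n gives ln p --> 0, hence p --> 1. Then 1 -
    p is squeezed between - p ln p and - ln p. *)
Lemma cvg_base_of_cvg_power (p : nat -> R) (g : R) : (forall n, 0 <= p n <= 1) ->
  0 < g -> p n ^+ n @[n --> \oo] --> g ->
  (p n @[n --> \oo] --> (1:R)) /\ (n%:R * (1 - p n) @[n --> \oo] --> - ln g).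
Proof.
move=> p01 g0 pg.
have pn0 : \forall n \near \oo, 0 < p n.
  near=> n.
  have : 0 < p n ^+ n by near: n; exact: (cvgr_gt _ pg).
  have n0 : (0 < n)%N by near: n; exact: nbhs_infty_gt.
  have /andP[+ _] := p01 n; rewrite le_eqVlt => /orP[/eqP <-|//].
  by rewrite expr0n gtn_eqF // ltxx.
have nln : n%:R * ln (p n) @[n --> \oo] --> ln g.
  apply: cvg_trans (continuous_cvg _ (continuous_ln g0) pg).
  apply: near_eq_cvg; near=> n.
  by rewrite /= lnXn ?mulr_natl //; near: n.
have pcvg : p n @[n --> \oo] --> (1:R).
  have lnp : ln (p n) @[n --> \oo] --> (0:R).
    rewrite -(mul0r (ln g)).
    apply: cvg_trans (cvgM cvg_invn nln).
    apply: near_eq_cvg; near=> n => /=.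
    by rewrite mulKf // pnatr_eq0 -lt0n; near: n; exact: nbhs_infty_gt.
  rewrite -expR0.
  apply: cvg_trans (continuous_cvg _ (@continuous_expR R 0) lnp).
  apply: near_eq_cvg; near=> n.
  rewrite /= lnK ?posrE //; near: n; exact: pn0.
split => //.
(* Both bounds come from ln (1 + t) <= t: with t = p - 1 for the upper one, with t = 1/p - 1 for the
   lower one. *)
apply: (@squeeze_cvgr _ _ _ _ (fun n => - (p n * (n%:R * ln (p n))))
  (fun n => - (n%:R * ln (p n)))).
- near=> n.
  have pp : 0 < p n by near: n.
  have h1 : ln (p n) <= p n - 1.
    by have := @le_ln1Dx R (p n - 1); rewrite (addrC 1) subrK; apply; lra.
  have h2 : - ln (p n) <= (p n)^-1 - 1.
    rewrite -lnV ?posrE //.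
    by have := @le_ln1Dx R ((p n)^-1 - 1); rewrite (addrC 1) subrK; apply;
      rewrite ltrBrDr addNr invr_gt0.
  have h3 : - (p n * ln (p n)) <= 1 - p n.
    by move: h2; rewrite -(ler_pM2l pp) mulrBr mulfV ?gt_eqF// mulr1 mulrN.
  have n0 : 0 <= n%:R :> R by [].
  by apply/andP; split; nra.
- rewrite -[in X in _ --> X](mul1r (ln g)); apply: cvgN; exact: cvgM.
- exact: cvgN.
Unshelve. all: by end_near.
Qed.

Section Asymptotics.
Variables (p : nat -> R) (g : R).
Hypotheses (p01 : forall n, 0 <= p n <= 1) (g0 : 0 < g).
Hypothesis pg : p n ^+ n @[n --> \oo] --> g.

Let p1 : p n @[n --> \oo] --> (1 : R) := (cvg_base_of_cvg_power p01 g0 pg).1.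
Let nq : n%:R * (1 - p n) @[n --> \oo] --> - ln g :=
  (cvg_base_of_cvg_power p01 g0 pg).2.
Let q0 : 1 - p n @[n --> \oo] --> (0 : R).
Proof. by rewrite -(subrr (1:R)); apply: cvgB => //; exact: cvg_cst. Qed.

(** The falling factorial has [j] factors [M + n - i], and each absorbs one factor q = 1 - p,
    becoming (M - i) q + n q, which tends to - ln g. The bound [j <= M] keeps [M - i] free of
    truncation. *)
Lemma cvg_bin_mulX (M j : nat) : (j <= M)%N ->
  'C(M + n, j)%:R * (1 - p n) ^+ j @[n --> \oo] --> (- ln g) ^+ j / j`!%:R.
Proof.
move=> jM.
have -> : (fun n => 'C(M + n, j)%:R * (1 - p n) ^+ j) =
  (fun n => (\prod_(i < j) ((M - i)%:R * (1 - p n) + n%:R * (1 - p n))) / j`!%:R).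
  apply/funext => n.
  apply: (canRL (mulfK _)); first by rewrite pnatr_eq0 -lt0n fact_gt0.
  rewrite mulrAC -natrM bin_ffact ffact_prod natr_prod.
  rewrite -[in (1 - p n) ^+ j](card_ord j) -prodr_const -big_split /=.
  apply: eq_bigr => i _.
  by rewrite -mulrDl -natrD addnBAC // (leq_trans _ jM) // ltnW.
apply: cvgM; last exact: cvg_cst.
have -> : (- ln g) ^+ j = \prod_(i < j) ((M - i)%:R * 0 - ln g).
  by under eq_bigr do rewrite mulr0 add0r; rewrite prodr_const card_ord.
apply: cvg_big => [|i _]; first exact: mul_continuous.
by apply: cvgD => //; apply: cvgM => //; exact: cvg_cst.
Qed.

Lemma cvg_binomial_mass (M j : nat) : (j <= M)%N ->
  binomial_mass (p n) (M + n) j @[n --> \oo] --> g * ((- ln g) ^+ j / j`!%:R).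
Proof.
move=> jM; rewrite /binomial_mass.
have -> : (fun n => 'C(M + n, j)%:R * p n ^+ (M + n - j) * (1 - p n) ^+ j) =
  (fun n => p n ^+ n * p n ^+ (M - j) * ('C(M + n, j)%:R * (1 - p n) ^+ j)).
  by apply/funext => n; rewrite -exprD addnC addnBA // [in RHS]mulrCA mulrA.
apply: cvgM (cvg_bin_mulX jM).
rewrite -[in X in _ --> X](mulr1 g) -(expr1n _ (M - j)).
by apply: cvgM => //; exact: cvgX_seq.
Qed.

Lemma cvg_binomial_cdf (M k : nat) : (k <= M.+1)%N ->
  binomial_cdf (p n) (M + n) k @[n --> \oo] -->
  g * \sum_(j < k) ((- ln g) ^+ j / j`!%:R).
Proof.
move=> kM; rewrite mulr_sumr.
apply: cvg_big => [|j _]; first exact: add_continuous.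
by apply: cvg_binomial_mass; rewrite -ltnS (leq_trans (ltn_ord j)).
Qed.

Lemma cvg_binomial_cdf_fixed (M k : nat) : (0 < k)%N ->
  binomial_cdf (p n) M k @[n --> \oo] --> (1 : R).
Proof.
case: k => // k _.
(* The limit is the same polynomial expression at p = 1, where only [j = 0] survives because 0^0 =
   1. *)
have -> : 1 = \sum_(j < k.+1) 'C(M, j)%:R * 1 ^+ (M - j) * 0 ^+ j :> R.
  rewrite big_ord_recl bin0 expr1n expr0 !mulr1 big1 ?addr0 // => i _.
  by rewrite expr0n mulr0.
apply: cvg_big => [|j _]; first exact: add_continuous.
apply: cvgM; last exact: cvgX_seq.
by apply: cvgM; [exact: cvg_cst | exact: cvgX_seq].
Qed.

Lemma cvg_mean_binomial_cdf (M k : nat) : (0 < k <= M)%N ->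
  n%:R^-1 * \sum_(M <= r < M + n) binomial_cdf (p n) r k @[n --> \oo] -->
  k%:R * log_quotient g -
  g * \sum_(1 <= l < k) (k - l)%:R * ((- ln g) ^+ (l - 1) / l`!%:R).
Proof.
move=> /andP[k0 kM].
have [g1|g1] := eqVneq g 1.
  rewrite /log_quotient g1 eqxx ln1 oppr0.
  (* With c = 0 only [l = 1] contributes, by 0^0 = 1, so the claimed limit is k - (k - 1) = 1; for
     [k = 1] the sum is empty. *)
  have -> : k%:R * 1 -
      1 * \sum_(1 <= l < k) (k - l)%:R * (0 ^+ (l - 1) / l`!%:R) = 1 :> R.
    case: k k0 kM => // -[_ _|k _ _]; first by rewrite big_geq // mulr0 subr0 mulr1.
    rewrite big_nat_recl // big_nat big1 => [|i /andP[i0 _]].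
      by rewrite subnn expr0 (_ : 1`! = 1%N) // divr1 !mulr1 mul1r addr0 subSS
        subn0 -natr1 addrAC subrr add0r.
    by rewrite subn1 expr0n gtn_eqF // mul0r mulr0.
  apply: (@squeeze_cvgr _ _ _ _ (fun n => p n ^+ n * p n ^+ M) (fun=> 1)).
  - near=> n.
    have n0 : (0 < n)%N by near: n; exact: nbhs_infty_gt.
    have nR0 : 0 < n%:R :> R by rewrite ltr0n.
    rewrite ler_pdivlMl // ler_pdivrMl // mulr1.
    have cn (x : R) : n%:R * x = \sum_(M <= r < M + n) x.
      by rewrite sumr_const_nat addKn mulr_natl.
    rewrite cn -[n%:R]mulr1 cn; apply/andP; split; apply: ler_sum_nat => r /andP[Mr rn].
      apply: le_trans (binomial_cdf_ge _ k0 (p01 n)).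
      by rewrite -exprD addnC ler_wiXn2l 1?ltnW //; case/andP: (p01 n).
    exact: binomial_cdf_le1.
  - suff : p n ^+ n * p n ^+ M @[n --> \oo] --> g * 1 ^+ M.
      by rewrite g1 expr1n mulr1.
    by apply: cvgM => //; exact: cvgX_seq.
  - exact: cvg_cst.
have c0 : - ln g != 0 by rewrite oppr_eq0 ln_eq0.
(* With c = - ln g nonzero, the claimed limit is put in the shape of the telescoped mean, whose
   limit can be taken termwise. *)
have -> : k%:R * log_quotient g -
    g * \sum_(1 <= l < k) (k - l)%:R * ((- ln g) ^+ (l - 1) / l`!%:R) =
    (- ln g)^-1 * \sum_(i < k) (1 - g * \sum_(j < i.+1) ((- ln g) ^+ j / j`!%:R)).
  rewrite /log_quotient (negPf g1) sumrB -mulr_sumr sum_exp_partial_sums.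
  rewrite sumr_const card_ord; set S := \sum_(_ <= _ < _) _.
  move: (- ln g) c0 S => c c0 S.
  by field.
apply: (@cvg_trans _ ((n%:R * (1 - p n))^-1 * \sum_(i < k)
    (binomial_cdf (p n) M i.+1 - binomial_cdf (p n) (M + n) i.+1)
    @[n --> \oo])).
  apply: near_eq_cvg; near=> n.
  have nq0 : n%:R * (1 - p n) != 0 by near: n; exact: (cvgr_neq0 _ nq).
  move: (nq0); rewrite mulf_eq0 negb_or => /andP[_ qn0].
  by rewrite -sum_binomial_cdf invfM mulrA mulfVK.
apply: cvgM; first exact: cvgV.
apply: cvg_big => [|i _]; first exact: add_continuous.
apply: cvgB; first exact: cvg_binomial_cdf_fixed.
by apply: cvg_binomial_cdf; rewrite (leq_trans (ltn_ord i)) // ltnW.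
Unshelve. all: by end_near.
Qed.

End Asymptotics.
End Limits.

(** * Order statistics and exceedance patterns *)

Local Open Scope order_scope.

(** The entry in question has index [size s - k], counted from 0, in the sorted list. It is at most
    [y] exactly when more than [size s - k] entries are, which leaves fewer than [k] above [y]. *)
Lemma order_stat_le (R : realType) (s : seq R) (k : nat) (y : R) :
  (0 < k <= size s)%N ->
  (order_stat s (size s - k + 1) <= y)%R = (count (> y)%R s < k)%N.
Proof.
move=> /andP[k0 ks]; rewrite /order_stat addn1 /=.
have srt : sorted <=%O (sort <=%O s) by exact: sort_le_sorted.
have szs : size (sort <=%O s) = size s by rewrite size_sort.
have csz : (count (> y)%R s <= size s)%N by exact: count_size.
have cle : count (<= y)%R (sort <=%O s) = (size s - count (> y)%R s)%N.
  by rewrite count_le_gt szs !count_sort.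
have [ck|kc] := ltnP.
  apply: nth_count_le => //.
  by rewrite [X in (_ < X)%N]cle ltn_sub2l // (leq_trans ck).
apply/negbTE; rewrite -ltNge; apply: nth_count_gt => //.
by rewrite [X in (X <= _)%N]cle leq_sub2l //= szs ltn_subrL k0 (leq_trans k0).
Qed.

Local Close Scope order_scope.

Section Exceedances.
Context d (T : measurableType d) (R : realType) (P : probability T R).
Variables (X : nat -> {RV P >-> R}) (y : R).

Definition exceedance_set r (S : {set 'I_r}) : set T :=
  [set w | forall i : 'I_r, (y < X i w) = (i \in S)].

(** Indexed by all of [nat], with [setT] from [r] on, because [mutually_independent] asks for a
    family of Borel sets over [nat]. *)
Definition exceedance_slot r (S : {set 'I_r}) (i : nat) : set R :=
  if insub i is Some j then
    if j \in S then `]y, +oo[%classic else `]-oo, y]%classic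
  else setT.

Lemma exceedance_slotE r (S : {set 'I_r}) (i : 'I_r) w :
  X i w \in exceedance_slot S i <-> (y < X i w) = (i \in S).
Proof.
rewrite /exceedance_slot valK inE; case: (i \in S) => /=.
  by rewrite in_itv /= andbT.
by rewrite in_itv /= leNgt; split=> [/negbTE|->].
Qed.

Lemma measurable_exceedance_slot r (S : {set 'I_r}) i :
  measurable (exceedance_slot S i).
Proof.
rewrite /exceedance_slot; case: insubP => // j _ _.
by case: (j \in S).
Qed.

Lemma exceedance_setE r (S : {set 'I_r}) : exceedance_set S =
  \bigcap_(i in [set` [fset j | j in iota 0 r]%fset]) (X i @^-1` exceedance_slot S i).
Proof.
apply/seteqP; split=> w /= Sw i.
  rewrite /= !inE mem_iota add0n => /andP[_ ir].
  by apply/set_mem/(exceedance_slotE S (Ordinal ir)); exact: Sw.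
apply/exceedance_slotE/mem_set; apply: Sw => /=.
by rewrite !inE mem_iota /= add0n.
Qed.

Lemma exceedance_count_ltE r k :
  [set w | (count (> y) [seq X i w | i <- iota 0 r] < k)%N] =
  \bigcup_(S in [set S : {set 'I_r} | (#|S| < k)%N]) exceedance_set S.
Proof.
have countE w : count (> y) [seq X i w | i <- iota 0 r] =
    #|[set i : 'I_r | y < X i w]%SET|.
  rewrite count_map -val_enum_ord count_map enumT cardE /enum_mem size_filter.
  by apply: eq_count => i; rewrite /= !inE.
apply/seteqP; split=> w /=.
  rewrite countE => wk; exists [set i : 'I_r | y < X i w]%SET => //= i.
  by rewrite inE.
move=> [S /= Sk Sw]; rewrite countE (_ : finset _ = S) //.
by apply/setP => i; rewrite inE Sw.
Qed.

Lemma trivIset_exceedance_set r (D : set {set 'I_r}) :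
  trivIset D (@exceedance_set r).
Proof.
move=> S S' _ _ [w [Sw S'w]]; apply/setP => i.
by rewrite -Sw -S'w.
Qed.

(** Independence of [N] from the sample is stated for events of the sigma-algebra generated by [X],
    so mere measurability in [T] would not suffice. *)
Lemma exceedance_count_lt_sigma r k : sigma_of_family X
  [set w | (count (> y) [seq X i w | i <- iota 0 r] < k)%N].
Proof.
rewrite exceedance_count_ltE.
(* [U] is [T] with that generated sigma-algebra, so the closure lemmas for measurable sets apply to
   it. *)
pose U := g_sigma_algebraType (\bigcup_i g_sigma_algebra_preimage (X i)).
apply: (@fin_bigcup_measurable _ U) => [|S _]; first exact: finite_finset.
rewrite exceedance_setE; apply: (@fin_bigcap_measurable _ U) => // i _.
apply: sub_sigma_algebra; exists i => //.
exists (exceedance_slot S i); first exact: measurable_exceedance_slot.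
by rewrite setTI.
Qed.

End Exceedances.

(** * Exceedance probabilities of an iid sample *)

Section IidExceedances.
Context d (T : measurableType d) (R : realType) (P : probability T R).
Variables (X : nat -> {RV P >-> R}) (F : R -> R) (y : R).
Hypothesis XF : iid_with_df X F.

Lemma probability_le i : P (X i @^-1` `]-oo, y]) = (F y)%:E.
Proof. exact: XF.2. Qed.

Lemma probability_gt i : P (X i @^-1` `]y, +oo[) = (1 - F y)%:E.
Proof.
have -> : X i @^-1` `]y, +oo[ = ~` (X i @^-1` `]-oo, y]).
  by rewrite preimage_setC setCitvl.
by rewrite probability_setC ?probability_le //; exact: measurable_funPTI.
Qed.

Lemma iid_df_ge0_le1 : 0 <= F y <= 1.
Proof.
rewrite -!lee_fin -(probability_le 0) measure_ge0 probability_le1 //.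
exact: measurable_funPTI.
Qed.

Lemma measurable_exceedance_set r (S : {set 'I_r}) :
  measurable (exceedance_set X y S).
Proof.
rewrite exceedance_setE; apply: fin_bigcap_measurable => // i _.
by apply: measurable_funPTI; exact: measurable_exceedance_slot.
Qed.

Lemma probability_exceedance_set r (S : {set 'I_r}) :
  P (exceedance_set X y S) = (F y ^+ (r - #|S|) * (1 - F y) ^+ #|S|)%:E.
Proof.
rewrite exceedance_setE XF.1; last exact: measurable_exceedance_slot.
rewrite (perm_big (iota 0 r)) /=; last first.
  by rewrite uniq_perm ?fset_uniq ?iota_uniq // => i; rewrite !inE.
rewrite -[X in iota 0 X]subn0 -/(index_iota 0 r) big_mkord.
under eq_bigr => i _.
  rewrite /exceedance_slot valK.
  rewrite (_ : P _ = (if i \in S then 1 - F y else F y)%:E); last first.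
    by case: ifP; rewrite ?probability_le ?probability_gt.
  over.
rewrite prodEFin big_if !prodr_const mulrC; congr (_ ^+ _ * _)%:E.
by rewrite -[X in (X - _)%N](card_ord r) -(cardC (mem S)) addKn.
Qed.

(** Distinct patterns are disjoint events, and the probability of a pattern depends only on its
    cardinality. *)
Lemma probability_exceedance_count_lt r k :
  P [set w | (count (> y) [seq X i w | i <- iota 0 r] < k)%N] =
  (binomial_cdf (F y) r k)%:E.
Proof.
rewrite exceedance_count_ltE measure_fin_bigcup; last 3 first.
- exact: finite_finset.
- exact: trivIset_exceedance_set.
- by move=> S _; exact: measurable_exceedance_set.
rewrite -(@bigfs _ _ _ _ (index_enum _)
  (fun S : {set 'I_r} => (#|S| < k)%N)); last 2 first.
- exact: index_enum_uniq.
- by move=> S _; rewrite mem_index_enum.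
transitivity (\sum_(S : {set 'I_r} | (#|S| < k)%N)
    (F y ^+ (r - #|S|) * (1 - F y) ^+ #|S|)%:E)%E.
  by apply: eq_bigr => S _; exact: probability_exceedance_set.
rewrite sumEFin (sum_subsets_card _ _ (fun j => F y ^+ (r - j) * (1 - F y) ^+ j)).
by congr (_%:E); apply: eq_bigr => j _; rewrite /binomial_mass mulrA.
Qed.

(* For r < k the truncated subtraction makes this the minimum (0 if r = 0);
   those junk values must be measurable too. *)
Lemma measurable_order_stat_le r k : (0 < k)%N ->
  measurable [set w | order_stat [seq X i w | i <- iota 0 r] (r - k + 1) <= y].
Proof.
have sz w : size [seq X i w | i <- iota 0 r] = r by rewrite size_map size_iota.
have exc j : measurable
    [set w | (count (> y) [seq X i w | i <- iota 0 r] < j)%N].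
  rewrite exceedance_count_ltE; apply: fin_bigcup_measurable => [|S _].
    exact: finite_finset.
  exact: measurable_exceedance_set.
move=> k0; have [->|r0] := posnP r.
  rewrite (_ : [set _ | _] = [set _ | 0 <= y]).
    by case: (0 <= y); [rewrite set_true | rewrite set_false].
  by apply/seteqP; split=> w /=; rewrite /order_stat ?nth_nil.
rewrite (_ : [set _ | _] =
  [set w | (count (> y) [seq X i w | i <- iota 0 r] < minn k r)%N]) //.
have -> : (r - k = r - minn k r)%N by rewrite minnE; lia.
apply/seteqP; split=> w /=; rewrite -[X in (X - _)%N](sz w) order_stat_le //.
all: by rewrite sz leq_min k0 r0 geq_minr.
Qed.

End IidExceedances.

(** * Conditioning on the random sample size *)

(** The [n] prescribed values carry mass 1/n each, hence total mass 1, so [N] lies outside the range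
    only on a null set. *)
Lemma probability_uniform_cases d (T : measurableType d) (R : realType)
    (P : probability T R) (N : {RV P >-> nat}) (M n : nat) (A : set T) :
  (0 < n)%N ->
  (forall r, (M <= r < M + n)%N -> P (N @^-1` [set r]) = (n%:R^-1)%:E) ->
  measurable A ->
  P A = (\sum_(M <= r < M + n) P (A `&` N @^-1` [set r]))%E.
Proof.
move=> n0 PN mA.
have mN r : measurable (N @^-1` [set r]) by exact: measurable_funPTI.
pose s := index_iota M (M + n).
have fs : finite_set [set` s] by exact: finite_seq.
pose D := \bigcup_(r in [set` s]) N @^-1` [set r].
have mD : measurable D by apply: fin_bigcup_measurable.
have tN B : trivIset [set` s] (fun r => B `&` N @^-1` [set r]).
  by move=> i j _ _ [w [[_ <-] [_ <-]]].
have PD : P D = 1%E.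
  rewrite measure_fin_bigcup //; last by move=> i j _ _ [w [<- <-]].
  rewrite -(@fsbig_seq _ _ _ _ s) ?iota_uniq //.
  transitivity (\sum_(M <= r < M + n) (n%:R^-1 : R)%:E)%E.
    by apply: eq_big_nat => r; exact: PN.
  rewrite sumEFin sumr_const_nat addKn -[_^-1 *+ n]mulr_natl mulfV //.
  by rewrite pnatr_eq0 -lt0n.
have PCD : P (~` D) = 0%E by rewrite probability_setC // PD subee.
have -> : P A = P (A `&` D).
  rewrite -[in LHS](setIT A) -(setUv D) setIUr measureU; first last.
  - by apply/seteqP; split => w // [[_ ?] [_ ?]].
  - by apply: measurableI => //; exact: measurableC.
  - exact: measurableI.
  rewrite [X in (_ + X)%E](_ : _ = 0%E) ?adde0 //.
  apply: (subset_measure0 _ _ _ PCD) => //; last exact: measurableC.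
  by apply: measurableI => //; exact: measurableC.
rewrite setI_bigcupr measure_fin_bigcup //; last first.
  by move=> r _; exact: measurableI.
by rewrite -(@fsbig_seq _ _ _ _ s) ?iota_uniq.
Qed.

(** Where [N] equals [r], the event concerns the first [r] sample points only, so independence
    factors its probability; [k <= M <= r] keeps the rank free of truncation. *)
Lemma df_kth_largest_uniform d (T : measurableType d) (R : realType)
    (P : probability T R) (X : nat -> {RV P >-> R}) (F : R -> R)
    (N : {RV P >-> nat}) (M n k : nat) (y : R) :
  iid_with_df X F -> independent_of_family N X -> (0 < n)%N ->
  (forall r, (M <= r < M + n)%N -> P (N @^-1` [set r]) = (n%:R^-1)%:E) ->
  (0 < k <= M)%N ->
  df_kth_largest X N k y =
  (n%:R^-1 * \sum_(M <= r < M + n) binomial_cdf (F y) r k)%:E.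
Proof.
move=> XF NX n0 PN /andP[k0 kM].
have mN r : measurable (N @^-1` [set r]) by exact: measurable_funPTI.
pose A r := [set w | order_stat [seq X i w | i <- iota 0 r] (r - k + 1) <= y].
have AN r : [set w | kth_largest X N k w <= y] `&` N @^-1` [set r] =
    N @^-1` [set r] `&` A r.
  apply/seteqP; split=> w; rewrite /A /kth_largest /=.
    by move=> [+ Nr]; rewrite Nr.
  by move=> [Nr]; rewrite Nr.
rewrite /df_kth_largest (probability_uniform_cases n0 PN); last first.
  (* Measurability must be checked over all values of [N], including those outside the range, where
     the order statistic may be junk. *)
  rewrite (_ : [set _ | _] = \bigcup_r (N @^-1` [set r] `&` A r)).
    apply: bigcup_measurable => r _; apply: measurableI => //.
    exact: measurable_order_stat_le.
  apply/seteqP; split=> [w wk|w [r _]]; last by rewrite -AN => -[].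
  by exists (N w) => //; rewrite -AN.
rewrite mulr_sumr -sumEFin; apply: eq_big_nat => r rM.
have kr : (k <= r)%N by rewrite (leq_trans kM) //; case/andP: rM.
have Ar : A r = [set w | (count (> y) [seq X i w | i <- iota 0 r] < k)%N].
  have sz w : size [seq X i w | i <- iota 0 r] = r by rewrite size_map size_iota.
  by apply/seteqP; split=> w; rewrite /A /= -[X in (X - _)%N](sz w)
    order_stat_le // sz k0.
rewrite AN Ar NX; last 2 first.
- by exists [set r] => //; rewrite setTI.
- exact: exceedance_count_lt_sigma.
by rewrite PN // (probability_exceedance_count_lt _ XF) EFinM.
Qed.

Theorem theorem3p1 (R : realType) (G : R -> R)
  (hG : is_extreme_value_df G)
  (F : cumulativeBounded (0 : R) (1 : R))
  (a b : nat -> R) (ha : forall n : nat, (1 <= n)%N -> 0 < a n)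
  (hF : forall x : R, F (a n * x + b n) ^+ n @[n --> \oo] --> G x)
  (m : nat) (hm : (1 <= m)%N)
  (d : measure_display) (T : measurableType d) (P : probability T R)
  (X : nat -> {RV P >-> R}) (hX : iid_with_df X F)
  (N : nat -> {RV P >-> nat})
  (hNX : forall n : nat, (1 <= n)%N -> independent_of_family (N n) X)
  (hN : forall n r : nat, (1 <= n)%N -> (m + 1 <= r <= m + n)%N ->
    P (N n @^-1` [set r]) = (n%:R^-1)%:E)
  (k : nat) (hk : (1 <= k <= m)%N) (x : R) (hx : 0 < G x) :
  df_kth_largest X (N n) k (a n * x + b n) @[n --> \oo] -->
  (k%:R * log_quotient (G x) -
   G x * \sum_(1 <= l < k)
           (k - l)%:R * ((- ln (G x)) ^+ (l - 1) / (l`!)%:R))%:E.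
Proof.
have /andP[k0 km] := hk.
pose p n := F (a n * x + b n).
have p01 n : 0 <= p n <= 1 := iid_df_ge0_le1 _ hX.
have kM : (0 < k <= m + 1)%N by rewrite k0 addn1 leqW.
(* Here M = m + 1: the values m + 1, ..., m + n form the half-open range from M to M + n. *)
have dfE n : (1 <= n)%N -> df_kth_largest X (N n) k (a n * x + b n) =
    (n%:R^-1 * \sum_(m + 1 <= r < m + 1 + n) binomial_cdf (p n) r k)%:E.
  move=> n0; apply: (df_kth_largest_uniform _ hX (hNX n n0)) => // r.
  by rewrite addnAC (addn1 (m + n)) ltnS; exact: hN.
(* The closed form is available for [n >= 1] only, so finiteness and equality are both claimed
   eventually. *)
apply: cvg_EFin.
  by near=> n; rewrite dfE //; near: n; exact: nbhs_infty_ge.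
apply: cvg_trans (cvg_mean_binomial_cdf p01 hx (hF x) kM).
apply: near_eq_cvg; near=> n; rewrite /= dfE //.
by near: n; exact: nbhs_infty_ge.
Unshelve. all: by end_near.
Qed.
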